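(* Let $k$ be a field. The category of Lie triple systems over $k$ is equivalent to the category (with graded homomorphisms as morphisms) of $\mathbb{Z}_2$-graded Lie algebras $L=L_0\oplus L_1$ over $k$ such that (i) $L$ is generated by $L_1$ as a Lie algebra, and (ii) the second graded cohomology group $H^2_{\rm gr}(L,M)$ is $0$ for every trivial $L$-module $M$ with the trivial grading $M=M_0$ (i.e. $M_1=0$).
   Context: A Lie triple system over $k$ is a $k$-module $T$ with a $k$-trilinear map $[\ ,\ ,\ ]:T\times T\times T\to T$ such that for all $a,b,c,d,e\in T$: $[a,a,b]=0$; $[a,b,c]+[b,c,a]+[c,a,b]=0$; $[a,b,[c,d,e]]=[[a,b,c],d,e]+[c,[a,b,d],e]+[c,d,[a,b,e]]$. A homomorphism of Lie triple systems is a $k$-linear map $\alpha$ with $\alpha([a,b,c])=[\alpha(a),\alpha(b),\alpha(c)]$; these are the morphisms of the category of Lie triple systems. No restriction on dimension or characteristic is made. A $\mathbb{Z}_2$-graded Lie algebra is a Lie algebra $L$ (with $[x,x]=0$ and the Jacobi identity) with a decomposition $L=L_0\oplus L_1$ into $k$-submodules such that $[L_i,L_j]\subseteq L_{i+j}$ for $i,j\in\mathbb{Z}_2=\{0,1\}$. A Lie algebra homomorphism $\varphi:L\to K$ of $\mathbb{Z}_2$-graded Lie algebras is graded if $\varphi(L_i)\subseteq K_i$ for $i\in\mathbb Z_2$. Graded cohomology: let $M=M_0\oplus M_1$ be a graded $L$-module ($L_i\cdot M_j\subseteq M_{i+j}$). Let $\mathrm{GrHom}_k(\wedge^n L,M)$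 be the set of $f\in\mathrm{Hom}_k(\wedge^n L,M)$ with $f(L_{i_1},\dots,L_{i_n})\subseteq M_{i_1+\dots+i_n}$ for all $i_1,\dots,i_n\in\mathbb{Z}_2$. These form a subcomplex of the Chevalley-Eilenberg complex with coboundary $$\delta f(x_1,\dots,x_{n+1})=\sum_{i}(-1)^{i+1}x_i\cdot f(x_1,\dots,\hat x_i,\dots,x_{n+1})+\sum_{i<j}(-1)^{i+j}f([x_i,x_j],x_1,\dots,\hat x_i,\dots,\hat x_j,\dots,x_{n+1}),$$ and $H^n_{\rm gr}(L,M)$ is its $n$-th cohomology group. A module is trivial if $L\cdot M=0$. *)

(* Defs.v *)
From HB Require Import structures.
From mathcomp Require Import all_boot all_order all_algebra all_classical.

Set Implicit Arguments.
Unset Strict Implicit.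
Unset Printing Implicit Defensive.

Import GRing.Theory.
Local Open Scope ring_scope.

(** * Categories *)

Record category := Category {
  obj :> Type;
  hom : obj -> obj -> Type;
  idm : forall x, hom x x;
  cmp : forall x y z, hom y z -> hom x y -> hom x z;
  cmpA : forall w x y z (h : hom y z) (g : hom x y) (f : hom w x),
    cmp h (cmp g f) = cmp (cmp h g) f;
  cmp1m : forall x y (f : hom x y), cmp (idm y) f = f;
  cmpm1 : forall x y (f : hom x y), cmp f (idm x) = f }.

Record functor (C D : category) := Functor {
  fobj :> C -> D;
  fmap : forall x y, hom x y -> hom (fobj x) (fobj y);
  fmap_id : forall x, fmap (idm x) = idm (fobj x);
  fmap_cmp : forall x y z (g : hom y z) (f : hom x y),
    fmap (cmp g f) = cmp (fmap g) (fmap f) }.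

Definition functor_id (C : category) : functor C C :=
  @Functor C C id (fun _ _ f => f) (fun _ => erefl) (fun _ _ _ _ _ => erefl).

Section FunctorComp.
Context (C D E : category) (G : functor D E) (F : functor C D).

Let map x y (f : hom x y) : hom (G (F x)) (G (F y)) := fmap G (fmap F f).

Fact functor_comp_id x : map (idm x) = idm (G (F x)).
Proof. by rewrite /map !fmap_id. Qed.

Fact functor_comp_cmp x y z (g : hom y z) (f : hom x y) :
  map (cmp g f) = cmp (map g) (map f).
Proof. by rewrite /map !fmap_cmp. Qed.

Definition functor_comp : functor C E :=
  @Functor C E (fun x => G (F x)) map functor_comp_id functor_comp_cmp.
End FunctorComp.

Definition isomorphism (C : category) (x y : C) (f : hom x y) : Prop :=
  exists g : hom y x, cmp g f = idm x /\ cmp f g = idm y.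

Definition nat_isomorphic (C D : category) (F G : functor C D) : Prop :=
  exists eta : forall x, hom (F x) (G x),
    (forall x y (f : hom x y), cmp (eta y) (fmap F f) = cmp (fmap G f) (eta x))
    /\ forall x, isomorphism (eta x).

Definition cat_equivalent (C D : category) : Prop :=
  exists (F : functor C D) (G : functor D C),
    nat_isomorphic (functor_comp G F) (functor_id C) /\
    nat_isomorphic (functor_comp F G) (functor_id D).

Definition full_subcategory (C : category) (P : C -> Prop) : category :=
  @Category {x : C | P x} (fun x y => hom (sval x) (sval y))
    (fun x => idm (sval x)) (fun _ _ _ g f => cmp g f)
    (fun _ _ _ _ h g f => cmpA h g f) (fun _ _ f => cmp1m f)
    (fun _ _ f => cmpm1 f).

(** * Lie triple systems *)

Record lieTriple (k : fieldType) := LieTriple {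
  lieTriple_sort :> lmodType k;
  tbr : lieTriple_sort -> lieTriple_sort -> lieTriple_sort -> lieTriple_sort;
  tbr_lin1 : forall b c, linear (fun a => tbr a b c);
  tbr_lin2 : forall a c, linear (fun b => tbr a b c);
  tbr_lin3 : forall a b, linear (fun c => tbr a b c);
  tbr_alt : forall a b, tbr a a b = 0;
  tbr_cyc : forall a b c, tbr a b c + tbr b c a + tbr c a b = 0;
  tbr_der : forall a b c d e,
    tbr a b (tbr c d e) =
      tbr (tbr a b c) d e + tbr c (tbr a b d) e + tbr c d (tbr a b e) }.

Record lieTriple_hom (k : fieldType) (S T : lieTriple k) := LieTripleHom {
  lieTriple_fun :> S -> T;
  lieTriple_fun_linear : linear lieTriple_fun;
  lieTriple_fun_tbr : forall a b c,
    lieTriple_fun (tbr a b c) =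
      tbr (lieTriple_fun a) (lieTriple_fun b) (lieTriple_fun c) }.

Section LieTripleCat.
Context (k : fieldType).
Implicit Types R S T U : lieTriple k.

Fact lieTriple_hom_eq S T (f g : lieTriple_hom S T) : f =1 g -> f = g.
Proof.
case: f g => [f fl fb] [g gl gb] /= /funext efg; move: gl gb; rewrite -efg => gl gb.
by congr LieTripleHom; exact: Prop_irrelevance.
Qed.

Definition lieTriple_id T : lieTriple_hom T T :=
  @LieTripleHom k T T id (fun _ _ _ => erefl) (fun _ _ _ => erefl).

Fact lieTriple_comp_linear S T U (g : lieTriple_hom T U)
  (f : lieTriple_hom S T) : linear (g \o f).
Proof. by move=> a x y; rewrite /= !lieTriple_fun_linear. Qed.

Fact lieTriple_comp_tbr S T U (g : lieTriple_hom T U) (f : lieTriple_hom S T)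
  a b c : (g \o f) (tbr a b c) = tbr ((g \o f) a) ((g \o f) b) ((g \o f) c).
Proof. by rewrite /= !lieTriple_fun_tbr. Qed.

Definition lieTriple_comp S T U (g : lieTriple_hom T U)
    (f : lieTriple_hom S T) : lieTriple_hom S U :=
  LieTripleHom (lieTriple_comp_linear g f) (lieTriple_comp_tbr g f).

Fact lieTriple_compA R S T U (h : lieTriple_hom T U) (g : lieTriple_hom S T)
  (f : lieTriple_hom R S) :
  lieTriple_comp h (lieTriple_comp g f) = lieTriple_comp (lieTriple_comp h g) f.
Proof. exact: lieTriple_hom_eq. Qed.

Fact lieTriple_comp1m S T (f : lieTriple_hom S T) :
  lieTriple_comp (lieTriple_id T) f = f.
Proof. exact: lieTriple_hom_eq. Qed.

Fact lieTriple_compm1 S T (f : lieTriple_hom S T) :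
  lieTriple_comp f (lieTriple_id S) = f.
Proof. exact: lieTriple_hom_eq. Qed.

Definition lieTripleCat : category :=
  Category lieTriple_compA lieTriple_comp1m lieTriple_compm1.
End LieTripleCat.

(** * Z/2-graded Lie algebras *)

Record lieAlg (k : fieldType) := LieAlg {
  lieAlg_sort :> lmodType k;
  lbr : lieAlg_sort -> lieAlg_sort -> lieAlg_sort;
  lbr_linl : forall y, linear (fun x => lbr x y);
  lbr_linr : forall x, linear (fun y => lbr x y);
  lbr_alt : forall x, lbr x x = 0;
  lbr_jacobi : forall x y z,
    lbr x (lbr y z) + lbr y (lbr z x) + lbr z (lbr x y) = 0 }.

Definition direct_decomposition (k : fieldType) (V : lmodType k)
    (V_ : 'Z_2 -> {pred V}) : Prop :=
  [/\ forall i, GRing.submod_closed (V_ i),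
      forall v, exists v0 v1, [/\ v0 \in V_ 0, v1 \in V_ 1 & v = v0 + v1]
    & forall v, v \in V_ 0 -> v \in V_ 1 -> v = 0].

Record grLie (k : fieldType) := GrLie {
  grLie_alg :> lieAlg k;
  gr : 'Z_2 -> {pred grLie_alg};
  gr_direct : direct_decomposition gr;
  gr_lbr : forall (i j : 'Z_2) x y,
    x \in gr i -> y \in gr j -> lbr x y \in gr (i + j) }.
Arguments gr {k} L i : rename.

Record grLie_hom (k : fieldType) (K L : grLie k) := GrLieHom {
  grLie_fun :> K -> L;
  grLie_fun_linear : linear grLie_fun;
  grLie_fun_lbr : forall x y,
    grLie_fun (lbr x y) = lbr (grLie_fun x) (grLie_fun y);
  grLie_fun_gr : forall i x, x \in gr K i -> grLie_fun x \in gr L i }.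

Section GrLieCat.
Context (k : fieldType).
Implicit Types J K L N : grLie k.

Fact grLie_hom_eq K L (f g : grLie_hom K L) : f =1 g -> f = g.
Proof.
case: f g => [f fl fb fd] [g gl gb gd] /= /funext efg.
move: gl gb gd; rewrite -efg => gl gb gd.
by congr GrLieHom; exact: Prop_irrelevance.
Qed.

Definition grLie_id L : grLie_hom L L :=
  @GrLieHom k L L id (fun _ _ _ => erefl) (fun _ _ => erefl) (fun _ _ h => h).

Fact grLie_comp_linear K L N (g : grLie_hom L N) (f : grLie_hom K L) :
  linear (g \o f).
Proof. by move=> a x y; rewrite /= !grLie_fun_linear. Qed.

Fact grLie_comp_lbr K L N (g : grLie_hom L N) (f : grLie_hom K L) x y :
  (g \o f) (lbr x y) = lbr ((g \o f) x) ((g \o f) y).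
Proof. by rewrite /= !grLie_fun_lbr. Qed.

Fact grLie_comp_gr K L N (g : grLie_hom L N) (f : grLie_hom K L) i x :
  x \in gr K i -> (g \o f) x \in gr N i.
Proof. by move=> xi; do 2!apply: grLie_fun_gr. Qed.

Definition grLie_comp K L N (g : grLie_hom L N) (f : grLie_hom K L) :
    grLie_hom K N :=
  GrLieHom (grLie_comp_linear g f) (grLie_comp_lbr g f) (grLie_comp_gr g f).

Fact grLie_compA J K L N (h : grLie_hom L N) (g : grLie_hom K L)
  (f : grLie_hom J K) :
  grLie_comp h (grLie_comp g f) = grLie_comp (grLie_comp h g) f.
Proof. exact: grLie_hom_eq. Qed.

Fact grLie_comp1m K L (f : grLie_hom K L) : grLie_comp (grLie_id L) f = f.
Proof. exact: grLie_hom_eq. Qed.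

Fact grLie_compm1 K L (f : grLie_hom K L) : grLie_comp f (grLie_id K) = f.
Proof. exact: grLie_hom_eq. Qed.

Definition grLieCat : category :=
  Category grLie_compA grLie_comp1m grLie_compm1.
End GrLieCat.

Definition lie_subalgebra (k : fieldType) (L : lieAlg k) (S : {pred L}) : Prop :=
  GRing.submod_closed S /\ {in S &, forall x y, lbr x y \in S}.

Definition lie_generated_by (k : fieldType) (L : lieAlg k) (X : {pred L}) : Prop :=
  forall S : {pred L}, lie_subalgebra S -> {subset X <= S} -> forall x, x \in S.

(** * Graded cohomology *)

Record grMod (k : fieldType) (L : grLie k) := GrMod {
  grMod_sort :> lmodType k;
  act : L -> grMod_sort -> grMod_sort;
  act_linl : forall m, linear (fun x => act x m);
  act_linr : forall x, linear (fun m => act x m);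
  act_lbr : forall x y m, act (lbr x y) m = act x (act y m) - act y (act x m);
  mgr : 'Z_2 -> {pred grMod_sort};
  mgr_direct : direct_decomposition mgr;
  act_mgr : forall (i j : 'Z_2) x m,
    x \in gr L i -> m \in mgr j -> act x m \in mgr (i + j) }.
Arguments mgr {k L} M i : rename.

Definition trivial_module (k : fieldType) (L : grLie k) (M : grMod L) : Prop :=
  forall (x : L) (m : M), act x m = 0.

Definition trivial_grading (k : fieldType) (L : grLie k) (M : grMod L) : Prop :=
  forall m : M, m \in mgr M 1 -> m = 0.

Section GradedCohomology.
Context (k : fieldType) (L : grLie k) (M : grMod L).

(* All functions of n arguments; those in Hom_k(/\^n L, M) are singled out
   by [alternating_multilinear]. *)
Local Notation cochain n := (('I_n -> L) -> M).

Definition upd n (x : 'I_n -> L) (i : 'I_n) (u : L) : 'I_n -> L :=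
  fun j => if j == i then u else x j.

Definition alternating_multilinear n (f : cochain n) : Prop :=
  (forall x i, linear (fun u => f (upd x i u))) /\
  (forall x i j, i != j -> x i = x j -> f x = 0).

Definition graded_map n (f : cochain n) : Prop :=
  forall (d : 'I_n -> 'Z_2) (x : 'I_n -> L),
    (forall j, x j \in gr L (d j)) -> f x \in mgr M (\sum_j d j).

Definition GrHom n : {pred cochain n} :=
  fun f => `[< alternating_multilinear f /\ graded_map f >].
Arguments GrHom : clear implicits.

Definition args n (s : seq L) : 'I_n -> L := fun p => nth 0 s p.

Definition omit n (x : 'I_n -> L) (s : seq 'I_n) : seq L :=
  [seq x l | l <- enum 'I_n & l \notin s].

(* Arguments are numbered from 0 here, which leaves (-1)^(i+j) unchanged and
   turns the usual (-1)^(i+1) into (-1)^i. *)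
Definition delta n (f : cochain n) : cochain n.+1 := fun x =>
  \sum_(i < n.+1) (-1) ^+ i *: act (x i) (f (args (omit x [:: i]))) +
  \sum_(i < n.+1) \sum_(j < n.+1 | (i < j)%N)
    (-1) ^+ (i + j) *: f (args (lbr (x i) (x j) :: omit x [:: i; j])).

Fact act_sub x m1 m2 : act x (m1 - m2) = act x m1 - act x m2 :> M.
Proof. by rewrite addrC -scaleN1r act_linr scaleN1r addrC. Qed.

Fact delta_sub n (f g : cochain n) : delta (f - g) = delta f - delta g.
Proof.
apply/funext => x; rewrite /delta !fctE opprD addrACA -!sumrB; congr (_ + _).
  by apply: eq_bigr => i _; rewrite act_sub scalerBr.
apply: eq_bigr => i _; rewrite -sumrB; apply: eq_bigr => j _.
by rewrite scalerBr.
Qed.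

Fact delta0 n : delta (0 : cochain n) = 0.
Proof. by rewrite -[X in delta X](subrr 0) delta_sub subrr. Qed.

Fact GrHom_zmod_closed n : zmod_closed (GrHom n).
Proof.
have cl i : GRing.submod_closed (mgr M i) by case: (mgr_direct M).
have cl0 i : 0 \in mgr M i by case: (cl i).
have clB i : {in mgr M i &, forall u v, u - v \in mgr M i}.
  by move=> u v uM vM; rewrite addrC -scaleN1r; case: (cl i) => _; apply.
have B0 m (f g : cochain m) x : (f - g) x = f x - g x by [].
split=> [|f g /asboolP[[fl fa] fd] /asboolP[[gl ga] gd]]; apply/asboolP.
  split; last by move=> d x _; exact: cl0.
  by split=> // x i a u v; rewrite -[LHS]/(0 : M) -[RHS]/(a *: (0 : M) + 0) scaler0 addr0.
split; last by move=> d x xd; apply: clB; [exact: fd|exact: gd].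
split=> [x i a u v|x i j ij xij].
  by rewrite !B0 fl gl scalerBr opprD addrACA.
by rewrite B0 (fa _ _ _ ij xij) (ga _ _ _ ij xij) subrr.
Qed.
HB.instance Definition _ n :=
  GRing.isZmodClosed.Build (cochain n) (GrHom n) (GrHom_zmod_closed n).

Definition cocycle n : {pred cochain n} :=
  fun f => (f \in GrHom n) && (delta f == 0).
Arguments cocycle : clear implicits.

Fact cocycle_zmod_closed n : zmod_closed (cocycle n).
Proof.
split=> [|f g /andP[fH /eqP df] /andP[gH /eqP dg]]; apply/andP.
  by rewrite rpred0 delta0.
by rewrite rpredB //= delta_sub df dg subrr.
Qed.
HB.instance Definition _ n :=
  GRing.isZmodClosed.Build (cochain n) (cocycle n) (cocycle_zmod_closed n).

Record Zgr n := ZGr { zgr_val :> cochain n; _ : zgr_val \in cocycle n }.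
HB.instance Definition _ n := [isSub for @zgr_val n].
HB.instance Definition _ n := [Choice of Zgr n by <:].
HB.instance Definition _ n := [SubChoice_isSubZmodule of Zgr n by <:].

Definition is_coboundary n : cochain n -> Prop :=
  match n with
  | 0 => fun f => f = 0
  | m.+1 => fun f => exists2 g, g \in GrHom m & f = delta g
  end.

Definition Bgr n : {pred Zgr n} := fun f => `[< is_coboundary (val f) >].
Arguments Bgr : clear implicits.

Fact Bgr_zmod_closed n : zmod_closed (Bgr n).
Proof.
case: n => [|n]; split=> [|f g /asboolP /= fB /asboolP /= gB]; apply/asboolP => //=.
- by rewrite fB gB subrr.
- by exists 0; rewrite ?rpred0 ?delta0.
- case: fB gB => [f' fH ->] [g' gH ->].
  by exists (f' - g'); rewrite ?rpredB ?delta_sub.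
Qed.
HB.instance Definition _ n :=
  GRing.isZmodClosed.Build (Zgr n) (Bgr n) (Bgr_zmod_closed n).

Definition Hgr n : zmodType := Quotient.quot (Bgr n).
End GradedCohomology.
Arguments Hgr {k L} M n.

(* Main.v *)
From HB Require Import structures.
Require Import Defs.
From mathcomp Require Import all_boot all_order all_algebra all_classical.

(* A Lie triple system T has a universal graded Lie algebra U(T) = U_0 + T, where
   U_0 is the exterior square of T, a left Leibniz algebra acting on T by
   derivations, modulo its squares. U(T) is generated by T, and a graded 2-cocycle
   with trivial even coefficients, restricted to T x T, extends linearly to U_0 and
   becomes its own primitive, so condition (ii) holds. Conversely L |-> L_1 sends a
   graded Lie algebra to a Lie triple system; when L_1 generates L, the counit
   U(L_1) -> L is onto with a central kernel contained in U_0. Lifting to U(L_1),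
   taking brackets there and projecting to U_0 gives a 2-cocycle of L with
   coefficients in U_0, independent of the lifts, and a primitive of it is a left
   inverse of U_0 -> L_0. Hence (ii) makes the counit an isomorphism. *)

Set Implicit Arguments.
Unset Strict Implicit.
Unset Printing Implicit Defensive.

Import GRing.Theory.
Local Open Scope ring_scope.
Local Open Scope quotient_scope.

(** * Linear functions *)

Section LinearFun.
Context (k : fieldType) (V W : lmodType k) (f : V -> W) (f_lin : linear f).

Lemma linfD u v : f (u + v) = f u + f v.
Proof. by rewrite -[u in LHS]scale1r f_lin scale1r. Qed.

Lemma linf0 : f 0 = 0.
Proof. by apply: (addIr (f 0)); rewrite -linfD !add0r. Qed.

Lemma linfZ a u : f (a *: u) = a *: f u.
Proof. by rewrite -[_ *: u]addr0 f_lin linf0 addr0. Qed.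

Lemma linfN u : f (- u) = - f u.
Proof. by rewrite -scaleN1r linfZ scaleN1r. Qed.

Lemma linfB u v : f (u - v) = f u - f v.
Proof. by rewrite linfD linfN. Qed.
End LinearFun.

(** * Modules given by generators and relations *)

(** Unreduced terms of the free module on an arbitrary type. The classical instances below are what
    the quotient construction asks for. *)
Inductive expr (k X : Type) : Type :=
  | EZero
  | EAdd of expr k X & expr k X
  | EScale of k & expr k X
  | EGen of X.
Arguments EZero {k X}.
Arguments EGen {k X} x.

HB.instance Definition _ (k X : Type) := gen_eqMixin (expr k X).
HB.instance Definition _ (k X : Type) := gen_choiceMixin (expr k X).

Section Eval.
Context (k : fieldType).

Fixpoint eval (X : Type) (M : lmodType k) (phi : X -> M) (e : expr k X) : M :=
  match e with
  | EZero => 0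
  | EAdd e1 e2 => eval phi e1 + eval phi e2
  | EScale a e1 => a *: eval phi e1
  | EGen x => phi x
  end.

Fixpoint substE (X Y : Type) (h : Y -> expr k X) (e : expr k Y) : expr k X :=
  match e with
  | EZero => EZero
  | EAdd e1 e2 => EAdd (substE h e1) (substE h e2)
  | EScale a e1 => EScale a (substE h e1)
  | EGen y => h y
  end.

Lemma eval_substE X Y (h : Y -> expr k X) (M : lmodType k) (phi : X -> M) e :
  eval phi (substE h e) = eval (eval phi \o h) e.
Proof. by elim: e => //= [e1 -> e2 ->|a e1 ->]. Qed.

Lemma eval_linear X (M N : lmodType k) (f : M -> N) (phi : X -> M) (e : expr k X) :
  linear f -> f (eval phi e) = eval (f \o phi) e.
Proof.
move=> f_lin; elim: e => //= [|e1 <- e2 <-|a e1 <-].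
- exact: linf0.
- exact: linfD.
- exact: linfZ.
Qed.

Lemma eval_ext X (M : lmodType k) (phi psi : X -> M) (e : expr k X) :
  phi =1 psi -> eval phi e = eval psi e.
Proof. by move=> eqf; elim: e => //= [e1 -> e2 ->|a e1 ->]. Qed.
End Eval.

Section Presented.
Context (k : fieldType) (X : Type) (R : expr k X -> expr k X -> Prop).

Definition compatible (M : lmodType k) (phi : X -> M) : Prop :=
  forall e e', R e e' -> eval phi e = eval phi e'.

(* The least congruence containing R that satisfies the module axioms, defined
   impredicatively: the axioms then hold because they hold in every M. *)
Definition econg (e e' : expr k X) : bool :=
  `[< forall (M : lmodType k) (phi : X -> M),
        compatible phi -> eval phi e = eval phi e' >].

Fact econg_refl : reflexive econg.
Proof. by move=> e; apply/asboolP. Qed.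

Fact econg_sym : symmetric econg.
Proof.
by move=> e e'; apply/asboolP/asboolP => H M phi cphi; rewrite H.
Qed.

Fact econg_trans : transitive econg.
Proof.
move=> e2 e1 e3 /asboolP H1 /asboolP H2; apply/asboolP => M phi cphi.
by rewrite H1 // H2.
Qed.

Canonical econg_equiv := EquivRel econg econg_refl econg_sym econg_trans.

Definition presented := {eq_quot econg_equiv}.
HB.instance Definition _ := Choice.on presented.
HB.instance Definition _ := EqQuotient.on presented.

(* Meaningful only for compatible [phi]; the general definition lets the lift be
   named before compatibility is proved. *)
Definition pres_lift (M : lmodType k) (phi : X -> M) (u : presented) : M :=
  eval phi (repr u).

Lemma pres_eqP e e' :
  (forall (M : lmodType k) (phi : X -> M),
     compatible phi -> eval phi e = eval phi e') ->
  \pi_presented e = \pi_presented e'.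
Proof. by move=> H; apply/eqmodP/asboolP. Qed.

(** [repr] returns only some expression congruent to [e], but a compatible [phi] evaluates congruent
    expressions equally. *)
Lemma pres_liftE (M : lmodType k) (phi : X -> M) e :
  compatible phi -> pres_lift phi (\pi_presented e) = eval phi e.
Proof.
move=> cphi; have /eqmodP/asboolP := reprK (\pi_presented e); exact.
Qed.

Definition pres_zero : presented := \pi_presented EZero.
Definition pres_add (u v : presented) : presented :=
  \pi_presented (EAdd (repr u) (repr v)).
Definition pres_opp (u : presented) : presented :=
  \pi_presented (EScale (-1) (repr u)).
Definition pres_scale a (u : presented) : presented :=
  \pi_presented (EScale a (repr u)).

Fact pres_addA : associative pres_add.
Proof.
(* Evaluations of representatives are folded back into [pres_lift], which [pres_liftE] then computes
   on the nested classes. *)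
by move=> u v w; apply: pres_eqP => M phi cphi /=;
   rewrite -!/(pres_lift phi _) !pres_liftE //= addrA.
Qed.

Fact pres_addC : commutative pres_add.
Proof. by move=> u v; apply: pres_eqP => M phi cphi /=; rewrite addrC. Qed.

Fact pres_add0 : left_id pres_zero pres_add.
Proof.
move=> u; rewrite -[RHS]reprK; apply: pres_eqP => M phi cphi /=.
by rewrite -!/(pres_lift phi _) !pres_liftE //= add0r.
Qed.

Fact pres_addN : left_inverse pres_zero pres_opp pres_add.
Proof.
move=> u; apply: pres_eqP => M phi cphi /=.
by rewrite -!/(pres_lift phi _) !pres_liftE //= scaleN1r addNr.
Qed.

HB.instance Definition _ :=
  GRing.isZmodule.Build presented pres_addA pres_addC pres_add0 pres_addN.

Fact pres_scaleA a b u : pres_scale a (pres_scale b u) = pres_scale (a * b) u.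
Proof.
apply: pres_eqP => M phi cphi /=.
by rewrite -!/(pres_lift phi _) !pres_liftE //= scalerA.
Qed.

Fact pres_scale1 : left_id 1 pres_scale.
Proof.
move=> u; rewrite -[RHS]reprK; apply: pres_eqP => M phi cphi /=.
by rewrite scale1r.
Qed.

Fact pres_scaleDr : right_distributive pres_scale +%R.
Proof.
move=> a u v; apply: pres_eqP => M phi cphi /=.
by rewrite -!/(pres_lift phi _) !pres_liftE //= scalerDr.
Qed.

Fact pres_scaleDl u : {morph pres_scale^~ u : a b / a + b}.
Proof.
move=> a b; apply: pres_eqP => M phi cphi /=.
by rewrite -!/(pres_lift phi _) !pres_liftE //= scalerDl.
Qed.

HB.instance Definition _ := GRing.Zmodule_isLmodule.Build k presented
  pres_scaleA pres_scale1 pres_scaleDr pres_scaleDl.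

Definition pres_gen (x : X) : presented := \pi_presented (EGen x).

(** Every class is thus an evaluation at the generators, so claims about it can be proved by
    induction on an expression. *)
Lemma eval_pres_gen e : eval pres_gen e = \pi_presented e.
Proof.
elim: e => //= [e1 -> e2 ->|a e1 ->]; apply: pres_eqP => M phi cphi /=;
  by rewrite -!/(pres_lift phi _) !pres_liftE.
Qed.

Lemma pres_gen_compatible : compatible pres_gen.
Proof.
move=> e e' Ree'; rewrite !eval_pres_gen; apply: pres_eqP => M phi; exact.
Qed.

Lemma pres_lift_gen (M : lmodType k) (phi : X -> M) x :
  compatible phi -> pres_lift phi (pres_gen x) = phi x.
Proof. exact: pres_liftE. Qed.

Lemma pres_lift_linear (M : lmodType k) (phi : X -> M) :
  compatible phi -> linear (pres_lift phi).
Proof.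
move=> cphi a u v; rewrite -[u]reprK -[v]reprK -!eval_pres_gen.
rewrite -[_ *: _ + _]/(eval pres_gen (EAdd (EScale a (repr u)) (repr v))).
by rewrite !eval_pres_gen !pres_liftE.
Qed.

Lemma pres_hom_ext (M : lmodType k) (f g : presented -> M) :
  linear f -> linear g -> (forall x, f (pres_gen x) = g (pres_gen x)) -> f =1 g.
Proof.
move=> f_lin g_lin eqfg u; rewrite -[u]reprK -eval_pres_gen.
by rewrite (eval_linear _ _ f_lin) (eval_linear _ _ g_lin); exact: eval_ext.
Qed.
End Presented.

(** * The even part of the universal enveloping Lie algebra *)

Section EvenPart.
Context (k : fieldType) (T : lieTriple k).
Implicit Types (a b c : T) (x y z : expr k (T * T)).

Definition eder x c : T := eval (fun p => tbr p.1 p.2 c) x.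

(** [x] acts on [y] through the derivation [eder x], extended to products. Working on expressions
    lets the relations below mention this bracket before the quotient exists. *)
Definition ebr x y : expr k (T * T) :=
  substE (fun p => EAdd (EGen (eder x p.1, p.2)) (EGen (p.1, eder x p.2))) y.

(* The first three relations give the exterior square of T, which [ebr] makes a
   left Leibniz algebra; killing its squares turns it into a Lie algebra. *)
Inductive even_rel : expr k (T * T) -> expr k (T * T) -> Prop :=
  | EvenLinl l a a' b :
      even_rel (EGen (l *: a + a', b))
        (EAdd (EScale l (EGen (a, b))) (EGen (a', b)))
  | EvenLinr l a b b' :
      even_rel (EGen (a, l *: b + b'))
        (EAdd (EScale l (EGen (a, b))) (EGen (a, b')))
  | EvenAlt a : even_rel (EGen (a, a)) EZero
  | EvenSquare x : even_rel (ebr x x) EZero.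

Definition bialternating (M : lmodType k) (w : T -> T -> M) : Prop :=
  [/\ forall b, linear (w^~ b), forall a, linear (w a) & forall a, w a a = 0].

Definition unc (M : Type) (w : T -> T -> M) (p : T * T) : M := w p.1 p.2.

Lemma bialternating_anti (M : lmodType k) (w : T -> T -> M) a b :
  bialternating w -> w a b = - w b a.
Proof.
case=> wl wr wa; apply/eqP; rewrite -addr_eq0; apply/eqP.
have := wa (a + b).
by rewrite (linfD (wl _)) !(linfD (wr _)) !wa add0r addr0.
Qed.

Lemma even_compatible (M : lmodType k) (w : T -> T -> M) :
  bialternating w -> (forall x, eval (unc w) (ebr x x) = 0) ->
  compatible even_rel (unc w).
Proof.
by move=> [wl wr wa] wsq e e' [l a a' b|l a b b'|a|x] /=;
   rewrite ?wsq // /unc /= ?wa // ?wl ?wr.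
Qed.

(** This is [w] composed with the extension of [f] to the exterior square as a derivation. *)
Definition leib (M : lmodType k) (w : T -> T -> M) (f : T -> T) x : M :=
  eval (fun p => w (f p.1) p.2 + w p.1 (f p.2)) x.

Lemma eval_ebr (M : lmodType k) (w : T -> T -> M) x y :
  eval (unc w) (ebr x y) = leib w (eder x) y.
Proof. by rewrite eval_substE; exact: eval_ext. Qed.

Lemma eder_linear x : linear (eder x).
Proof.
move=> l c c'; rewrite /eder; elim: x => /= [|x -> y ->|m x ->|[a b]].
- by rewrite scaler0 addr0.
- by rewrite scalerDr addrACA.
- by rewrite scalerDr !scalerA mulrC.
- exact: tbr_lin3.
Qed.

(** Each generator acts as a derivation by [tbr_der], and derivations are closed under linear
    combinations. *)
Lemma eder_tbr x a b c :
  eder x (tbr a b c) = tbr (eder x a) b c + tbr a (eder x b) c + tbr a b (eder x c).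
Proof.
have l1 b' c' := tbr_lin1 b' c'; have l2 a' c' := tbr_lin2 a' c'.
have l3 a' b' := tbr_lin3 a' b'.
rewrite /eder; elim: x => /= [|x -> y ->|m x ->|[d e]].
- by rewrite (linf0 (l1 _ _)) (linf0 (l2 _ _)) (linf0 (l3 _ _)) !addr0.
- rewrite (linfD (l1 _ _)) (linfD (l2 _ _)) (linfD (l3 _ _)).
  by rewrite addrACA (addrACA (tbr _ _ _)).
- by rewrite (linfZ (l1 _ _)) (linfZ (l2 _ _)) (linfZ (l3 _ _)) !scalerDr.
- exact: tbr_der.
Qed.

(** For a generator [(a, b)] of [y] this is the derivation rule [eder_tbr], solved for the terms in
    which [eder x] hits [a] or [b]. *)
Lemma eder_ebr x y c : eder (ebr x y) c = eder x (eder y c) - eder y (eder x c).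
Proof.
rewrite {1}/eder /ebr eval_substE.
elim: y => /= [|y -> z ->|m y ->|[a b]].
- by rewrite (linf0 (eder_linear _)) subrr.
- by rewrite (linfD (eder_linear _)) opprD addrACA.
- by rewrite (linfZ (eder_linear _)) scalerBr.
- by rewrite [eder (EGen _) c]/= eder_tbr addrK.
Qed.

Lemma eder_bialternating c : bialternating (fun a b => tbr a b c).
Proof.
split=> [b|a|a]; [exact: tbr_lin1|exact: tbr_lin2|exact: tbr_alt].
Qed.

(** Squares act by zero, because they act by the commutator of a derivation with itself. *)
Lemma eder_compatible c : compatible even_rel (unc (fun a b => tbr a b c)).
Proof.
apply: even_compatible (eder_bialternating c) _ => x.
by rewrite -/(eder _ _) eder_ebr subrr.
Qed.

Definition evenPart : lmodType k := presented even_rel.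
Implicit Types u v : evenPart.

Definition wdg a b : evenPart := pres_gen even_rel (a, b).

Lemma wdg_bialternating : bialternating wdg.
Proof.
split=> [b l a a'|a l b b'|a].
- exact: (pres_gen_compatible (EvenLinl l a a' b)).
- exact: (pres_gen_compatible (EvenLinr l a b b')).
- exact: (pres_gen_compatible (EvenAlt a)).
Qed.

Lemma eval_wdg x : eval (unc wdg) x = \pi_(presented even_rel) x.
Proof. by rewrite -eval_pres_gen; apply: eval_ext => -[]. Qed.

Lemma pi_ebr x y : \pi_(presented even_rel) (ebr x y) = leib wdg (eder x) y.
Proof. by rewrite -eval_wdg eval_ebr. Qed.

Section Leib.
Context (M : lmodType k) (w : T -> T -> M) (w_alt : bialternating w).

Let wl b : linear (w^~ b). Proof. by case: w_alt. Qed.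
Let wr a : linear (w a). Proof. by case: w_alt. Qed.
Let wa a : w a a = 0. Proof. by case: w_alt. Qed.

Lemma leib_bialternating (f : T -> T) :
  linear f -> bialternating (fun a b => w (f a) b + w a (f b)).
Proof.
move=> f_lin; split=> [b l a a'|a l b b'|a].
- by rewrite f_lin !wl scalerDr addrACA.
- by rewrite f_lin !wr scalerDr addrACA.
- by rewrite (bialternating_anti _ _ w_alt) addNr.
Qed.

Lemma leib_lin l (f g : T -> T) x :
  leib w (fun c => l *: f c + g c) x = l *: leib w f x + leib w g x.
Proof.
rewrite /leib; elim: x => /= [|x -> y ->|m x ->|p].
- by rewrite scaler0 addr0.
- by rewrite scalerDr addrACA.
- by rewrite scalerDr !scalerA mulrC.
- by rewrite wl wr scalerDr addrACA.
Qed.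

(** The mixed terms [w (f a) (g b)] and [w (g a) (f b)] are the same for both orders of applying [f]
    and [g], so only the commutator survives in the difference. *)
Lemma leib_comm (f g : T -> T) x : linear f -> linear g ->
  leib (fun a b => w (f a) b + w a (f b)) g x =
  leib w (fun c => f (g c) - g (f c)) x +
  leib (fun a b => w (g a) b + w a (g b)) f x.
Proof.
move=> f_lin g_lin; rewrite /leib; elim: x => /= [|x -> y ->|m x ->|[a b]] /=.
- by rewrite addr0.
- by rewrite addrACA.
- by rewrite scalerDr.
rewrite (linfB (wl _)) (linfB (wr _)).
rewrite [RHS](AC ((2*2)*(2*2)) (((1*7)*(6*3))*((5*2)*(8*4))))/=.
by rewrite !subrr !addr0.
Qed.
End Leib.

Lemma leib_ext (M : lmodType k) (w : T -> T -> M) (f g : T -> T) x :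
  f =1 g -> leib w f x = leib w g x.
Proof. by move=> /funext ->. Qed.

(** The left Leibniz identity: [leib_comm] for the derivations [eder z] and [eder x], whose
    commutator is [eder (ebr z x)]. *)
Lemma pi_ebr_ebr z x y :
  \pi_(presented even_rel) (ebr z (ebr x y)) =
  \pi_(presented even_rel) (ebr (ebr z x) y) +
  \pi_(presented even_rel) (ebr x (ebr z y)).
Proof.
have W := wdg_bialternating.
have expand z1 x1 y1 : \pi_(presented even_rel) (ebr z1 (ebr x1 y1)) =
    leib (fun a b => wdg (eder z1 a) b + wdg a (eder z1 b)) (eder x1) y1.
  by rewrite pi_ebr
    -(eval_ebr (fun a b => wdg (eder z1 a) b + wdg a (eder z1 b))).
rewrite !expand (leib_comm W _ (eder_linear z) (eder_linear x)).
by rewrite pi_ebr; congr (_ + _); apply: leib_ext => c; rewrite eder_ebr.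
Qed.

(** Polarisation of the square relation. *)
Lemma pi_ebr_anti x y :
  \pi_(presented even_rel) (ebr x y) + \pi_(presented even_rel) (ebr y x) = 0.
Proof.
have sq z : \pi_(presented even_rel) (ebr z z) = 0.
  by rewrite -eval_pres_gen (pres_gen_compatible (EvenSquare z)).
have := sq (EAdd x y); rewrite pi_ebr.
have -> : leib wdg (eder (EAdd x y)) (EAdd x y) =
    leib wdg (eder x) (EAdd x y) + leib wdg (eder y) (EAdd x y).
  rewrite -[X in X + _]scale1r -(leib_lin wdg_bialternating).
  by apply: leib_ext => c; rewrite scale1r.
rewrite {1 2}/leib /= -!/(leib _ _ _) -!pi_ebr !sq add0r addr0; exact.
Qed.

Definition dact u c : T := pres_lift (unc (fun a b => tbr a b c)) u.

Lemma dact_pi x c : dact (\pi_(presented even_rel) x) c = eder x c.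
Proof. exact: pres_liftE (eder_compatible c). Qed.

Lemma dact_linl c : linear (dact^~ c).
Proof. exact: pres_lift_linear (eder_compatible c). Qed.

Lemma dact_linr u : linear (dact u).
Proof. by rewrite -[u]reprK => l c c'; rewrite !dact_pi eder_linear. Qed.

Lemma dact_wdg a b c : dact (wdg a b) c = tbr a b c.
Proof. exact: pres_lift_gen (eder_compatible c). Qed.

(** The first argument enters only through its action [dact u], so only the second has to be lifted
    through the relations here. *)
Definition ebrk u v : evenPart :=
  pres_lift (unc (fun a b => wdg (dact u a) b + wdg a (dact u b))) v.

Lemma leib_compatible u :
  compatible even_rel (unc (fun a b => wdg (dact u a) b + wdg a (dact u b))).
Proof.
rewrite -[u]reprK; move: (repr u) => z.
have -> : dact (\pi_(presented even_rel) z) = eder z.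
  by apply/funext => c; exact: dact_pi.
apply: even_compatible => [|x].
  exact: leib_bialternating wdg_bialternating _ (eder_linear z).
(* By the Leibniz identity z(xx) = (zx)x + x(zx), which vanishes by anticommutativity. *)
rewrite -[LHS]/(leib wdg (eder z) (ebr x x)) -pi_ebr pi_ebr_ebr.
exact: pi_ebr_anti.
Qed.

Lemma ebrk_pi x y : ebrk (\pi_(presented even_rel) x) (\pi_(presented even_rel) y) =
  \pi_(presented even_rel) (ebr x y).
Proof.
rewrite pi_ebr /ebrk pres_liftE; last exact: leib_compatible.
by apply: eval_ext => p; rewrite /unc !dact_pi.
Qed.

Lemma ebrk_linr u : linear (ebrk u).
Proof. exact: pres_lift_linear (@leib_compatible u). Qed.

Lemma ebrk_anti u v : ebrk u v + ebrk v u = 0.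
Proof. by rewrite -[u]reprK -[v]reprK !ebrk_pi pi_ebr_anti. Qed.

Lemma ebrk_linl v : linear (ebrk^~ v).
Proof.
have anti u : ebrk u v = - ebrk v u by apply/eqP; rewrite -addr_eq0 ebrk_anti.
by move=> l u u'; rewrite !anti ebrk_linr opprD scalerN.
Qed.

Lemma ebrk_alt u : ebrk u u = 0.
Proof.
rewrite -[u]reprK ebrk_pi -eval_pres_gen.
exact: (pres_gen_compatible (EvenSquare (repr u))).
Qed.

Lemma ebrkA u v v' : ebrk u (ebrk v v') = ebrk (ebrk u v) v' + ebrk v (ebrk u v').
Proof. by rewrite -[u]reprK -[v]reprK -[v']reprK !ebrk_pi pi_ebr_ebr. Qed.

Lemma dact_ebrk u v c : dact (ebrk u v) c = dact u (dact v c) - dact v (dact u c).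
Proof. by rewrite -[u]reprK -[v]reprK ebrk_pi !dact_pi eder_ebr. Qed.

Lemma ebrk_wdg u a b : ebrk u (wdg a b) = wdg (dact u a) b + wdg a (dact u b).
Proof. exact: pres_lift_gen (leib_compatible u). Qed.

Lemma even_hom_ext (M : lmodType k) (f g : evenPart -> M) : linear f -> linear g ->
  (forall a b, f (wdg a b) = g (wdg a b)) -> f =1 g.
Proof. by move=> fl gl eqfg; apply: pres_hom_ext fl gl _ => -[a b]; exact: eqfg. Qed.

Definition even_lift (M : lmodType k) (w : T -> T -> M) u : M :=
  pres_lift (unc w) u.

Section EvenLift.
(* [B] plays the role of a bracket on the values of the lift: either the bracket
   of a target Lie algebra, or a scalar 2-cocycle. It takes an expression as
   first argument because the lift is not known to be well defined yet. *)
Context (M N : lmodType k) (w : T -> T -> M) (w' : T -> T -> N).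
Context (B : expr k (T * T) -> N -> M).
Hypotheses (w_alt : bialternating w) (B_linr : forall x, linear (B x)).
Hypothesis B_gen :
  forall x a b, B x (w' a b) = w (eder x a) b + w a (eder x b).
Hypothesis B_alt : forall x, B x (eval (unc w') x) = 0.

Lemma eval_ebr_lift x y : eval (unc w) (ebr x y) = B x (eval (unc w') y).
Proof.
rewrite eval_ebr (eval_linear _ _ (B_linr _)).
by apply: eval_ext => p; rewrite /= B_gen.
Qed.

(** By [eval_ebr_lift] a square evaluates to the pairing of [x] with its own value, which [B_alt]
    kills. *)
Lemma even_lift_compatible : compatible even_rel (unc w).
Proof. by apply: even_compatible w_alt _ => x; rewrite eval_ebr_lift. Qed.

Lemma even_lift_linear : linear (even_lift w).
Proof. exact: pres_lift_linear even_lift_compatible. Qed.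

Lemma even_lift_pi x : even_lift w (\pi_(presented even_rel) x) = eval (unc w) x.
Proof. exact: pres_liftE even_lift_compatible. Qed.

Lemma even_lift_wdg a b : even_lift w (wdg a b) = w a b.
Proof. exact: even_lift_pi. Qed.

Lemma even_lift_ebrk x y :
  even_lift w (ebrk (\pi_(presented even_rel) x) (\pi_(presented even_rel) y)) =
  B x (eval (unc w') y).
Proof. by rewrite ebrk_pi even_lift_pi eval_ebr_lift. Qed.
End EvenLift.
End EvenPart.
Arguments wdg {k T} a b.
Arguments dact {k T} u c.
Arguments ebrk {k T} u v.

(** * The universal enveloping graded Lie algebra *)

Lemma Z2_case (P : 'Z_2 -> Prop) : P 0 -> P 1 -> forall i, P i.
Proof.
move=> P0 P1 [[|[|//]] lt_i].
  by rewrite (_ : Ordinal _ = 0) //; exact: val_inj.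
by rewrite (_ : Ordinal _ = 1) //; exact: val_inj.
Qed.

Lemma Z2_1D1 : 1 + 1 = 0 :> 'Z_2. Proof. exact: val_inj. Qed.

Section Envelope.
Context (k : fieldType) (T : lieTriple k).
Local Notation U := (evenPart T * T)%type.
Implicit Types x y z : U.

Let wdg_l := (let: And3 wl _ _ := wdg_bialternating T in wl).
Let wdg_r := (let: And3 _ wr _ := wdg_bialternating T in wr).
Let wdg_a := (let: And3 _ _ wa := wdg_bialternating T in wa).

Definition env_lbr x y : U :=
  (ebrk x.1 y.1 + wdg x.2 y.2, dact x.1 y.2 - dact y.1 x.2).

Fact env_lbr_anti x y : env_lbr x y = - env_lbr y x.
Proof.
rewrite /env_lbr; congr (_, _) => /=; last by rewrite opprB.
rewrite opprD (bialternating_anti _ _ (wdg_bialternating T)); congr (_ + _).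
by apply/eqP; rewrite -addr_eq0 ebrk_anti.
Qed.

Fact env_lbr_linr x : linear (env_lbr x).
Proof.
move=> l y z; congr (_, _) => /=.
  by rewrite ebrk_linr wdg_r scalerDr addrACA.
by rewrite dact_linr dact_linl scalerBr opprD addrACA.
Qed.

Fact env_lbr_linl y : linear (env_lbr^~ y).
Proof.
move=> l x x'.
by rewrite env_lbr_anti env_lbr_linr opprD -scalerN -!env_lbr_anti.
Qed.

Fact env_lbr_alt x : env_lbr x x = 0.
Proof. by rewrite /env_lbr ebrk_alt wdg_a subrr addr0. Qed.

Fact env_lbr_jacobi x y z :
  env_lbr x (env_lbr y z) + env_lbr y (env_lbr z x) + env_lbr z (env_lbr x y) = 0.
Proof.
have wanti := bialternating_anti _ _ (wdg_bialternating T).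
have eanti u v : ebrk u v = - ebrk v u :> evenPart T.
  by apply/eqP; rewrite -addr_eq0 ebrk_anti.
case: x y z => [u a] [v b] [w c]; rewrite /env_lbr /=; congr (_, _) => /=.
  (* Even component: expanding by the derivation rule [ebrk_wdg] and the Leibniz rule [ebrkA] leaves
     terms that cancel in pairs. *)
  rewrite !(linfD (ebrk_linr _)) !(linfB (wdg_r _)) !ebrk_wdg.
  rewrite (wanti c (dact u b)) (wanti a (dact v c)) (wanti b (dact w a)).
  rewrite (ebrkA u v w) (eanti (ebrk u v)) (eanti w u) (linfN (ebrk_linr v)).
  set A := ebrk w _; set B := ebrk v _.
  rewrite [LHS](AC ((((2*2)*2)*((1*2)*2))*((1*2)*2))
    ((1*12)*(2*7)*(3*15)*(4*11)*(5*8)*(6*14)*(9*16)*(10*13)))/=.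
  by rewrite !(subrr, addNr, addr0).
(* Odd component: the iterated actions cancel through [dact_ebrk], and the three triple products
   left over vanish by the cyclic identity. *)
rewrite !(linfD (dact_linl _)) !(linfB (dact_linr _)) !dact_ebrk !dact_wdg.
rewrite !opprD !opprK.
rewrite [LHS](AC (((2*3)*(2*3))*(2*3))
  ((1*13)*(2*9)*(3*6)*(4*12)*(7*14)*(8*11)*(5*10*15)))/=.
by rewrite !(subrr, addNr, addr0, add0r) -!opprD tbr_cyc oppr0.
Qed.

Definition env_lie : lieAlg k :=
  LieAlg env_lbr_linl env_lbr_linr env_lbr_alt env_lbr_jacobi.

Definition env_gr (i : 'Z_2) : {pred env_lie} :=
  fun x => if i == 0 then x.2 == 0 else x.1 == 0.

Lemma env_gr0 (x : env_lie) : (x \in env_gr 0) = (x.2 == 0). Proof. by []. Qed.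
Lemma env_gr1 (x : env_lie) : (x \in env_gr 1) = (x.1 == 0). Proof. by []. Qed.

Fact env_gr_direct : direct_decomposition env_gr.
Proof.
split.
- elim/Z2_case; split=> [|l x y]; rewrite ?env_gr0 ?env_gr1 //= => /eqP-> /eqP->.
    by rewrite scaler0 addr0.
  by rewrite scaler0 addr0.
- case=> u a; exists (u, 0), (0, a); rewrite env_gr0 env_gr1 /= !eqxx.
  by split=> //; congr (_, _); rewrite ?addr0 ?add0r.
- by case=> u a; rewrite env_gr0 env_gr1 /= => /eqP-> /eqP->.
Qed.

Fact env_gr_lbr (i j : 'Z_2) (x y : env_lie) :
  x \in env_gr i -> y \in env_gr j -> lbr x y \in env_gr (i + j).
Proof.
case: x y => [u a] [v b].
elim/Z2_case: i; elim/Z2_case: j;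
  rewrite ?Z2_1D1 ?add0r ?addr0 ?env_gr0 ?env_gr1 /= => /eqP-> /eqP->.
- by rewrite (linf0 (dact_linr _)) (linf0 (dact_linr _)) subr0.
- by rewrite (linf0 (ebrk_linr _)) (linf0 (wdg_l _)) addr0.
- by rewrite (linf0 (ebrk_linl _)) (linf0 (wdg_r _)) addr0.
- by rewrite !(linf0 (dact_linl _)) subr0.
Qed.

Definition envelope : grLie k := GrLie env_gr_direct env_gr_lbr.

(** The even part is spanned by wedges, and each wedge is the bracket of two odd elements. *)
Lemma env_generated : lie_generated_by (gr envelope 1).
Proof.
move=> S [[S0 Slin] Slbr] sub1 [u a].
have S1 b : ((0, b) : envelope) \in S by apply: sub1; rewrite env_gr1.
have SD x y : x \in S -> y \in S -> x + y \in S.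
  by move=> xS yS; rewrite -[x]scale1r Slin.
have -> : (u, a) = (u, 0) + (0, a) :> envelope.
  by congr (_, _); rewrite ?addr0 ?add0r.
apply: (SD) => //; elim/quotW: u => e; rewrite -eval_wdg.
elim: e => /= [|e1 IH1 e2 IH2|l e IH|[b c]] //=.
- have -> : (eval (unc wdg) e1 + eval (unc wdg) e2, 0) =
     (eval (unc wdg) e1, 0) + (eval (unc wdg) e2, 0) :> envelope.
    by congr (_, _); rewrite ?addr0.
  exact: SD.
- have -> : (l *: eval (unc wdg) e, 0) = l *: (eval (unc wdg) e, 0) + 0 :> envelope.
    by congr (_, _); rewrite /= ?scaler0 addr0.
  exact: Slin.
- have -> : (unc wdg (b, c), 0) = lbr ((0, b) : envelope) (0, c) :> envelope.
    congr (_, _) => /=.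
      by rewrite (linf0 (ebrk_linr _)) add0r.
    by rewrite !(linf0 (dact_linl _)) subrr.
  exact: Slbr.
Qed.
End Envelope.

(** * Lie algebra identities and the universal property of the envelope *)

Section LieAlgTheory.
Context (k : fieldType) (L : lieAlg k).
Implicit Types x y z : L.

Lemma lbr_anti x y : lbr x y = - lbr y x.
Proof.
apply/eqP; rewrite -addr_eq0; apply/eqP; have := lbr_alt (x + y).
rewrite (linfD (lbr_linl _)) !(linfD (lbr_linr _)) !lbr_alt add0r addr0; exact.
Qed.

Lemma lbr_der x y z : lbr x (lbr y z) = lbr (lbr x y) z + lbr y (lbr x z).
Proof.
have /eqP := lbr_jacobi x y z; rewrite -addrA addr_eq0 => /eqP ->.
rewrite (lbr_anti (lbr x y)) (lbr_anti x z) (linfN (lbr_linr _)) opprD addrC.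
by rewrite (lbr_anti z x) (linfN (lbr_linr _)) opprK.
Qed.
End LieAlgTheory.

Section UniversalProperty.
Context (k : fieldType) (T : lieTriple k) (L : lieAlg k) (phi : T -> L).
Hypothesis phi_lin : linear phi.
Hypothesis phi_tbr : forall a b c, phi (tbr a b c) = lbr (lbr (phi a) (phi b)) (phi c).

Let w a b := lbr (phi a) (phi b).
Let B (x : expr k (T * T)) := lbr (eval (unc w) x).

Definition env_ext (x : envelope T) : L := even_lift w x.1 + phi x.2.

Let w_alt : bialternating w.
Proof.
split=> [b l a a'|a l b b'|a]; rewrite /w ?lbr_alt //.
  by rewrite phi_lin lbr_linl.
by rewrite phi_lin lbr_linr.
Qed.

(** The hypothesis [phi_tbr] extended linearly from generators: bracketing with the image of [x]
    realises [eder x] on the image of [phi]. It yields [B_gen]. *)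
Let B_phi x c : B x (phi c) = phi (eder x c).
Proof.
rewrite /B /eder (eval_linear _ _ phi_lin).
rewrite (eval_linear (f := fun z => lbr z (phi c)) _ _ (lbr_linl _)).
by apply: eval_ext => p; rewrite /= phi_tbr.
Qed.

Let B_linr x : linear (B x). Proof. exact: lbr_linr. Qed.

Let B_gen x a b : B x (w a b) = w (eder x a) b + w a (eder x b).
Proof. by rewrite /w -!B_phi /B lbr_der. Qed.

Let B_alt x : B x (eval (unc w) x) = 0. Proof. exact: lbr_alt. Qed.

Let rho := even_lift w.
Let rho_linear : linear rho := even_lift_linear w_alt B_linr B_gen B_alt.
Let rho_wdg a b : rho (wdg a b) = w a b := even_lift_wdg w_alt B_linr B_gen B_alt a b.

Let rho_ebrk u v : rho (ebrk u v) = lbr (rho u) (rho v).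
Proof.
elim/quotW: u => x; elim/quotW: v => y.
by rewrite /rho (even_lift_ebrk w_alt B_linr B_gen B_alt)
           !(even_lift_pi w_alt B_linr B_gen B_alt).
Qed.

Let rho_dact u c : lbr (rho u) (phi c) = phi (dact u c).
Proof.
elim/quotW: u => x.
by rewrite /rho (even_lift_pi w_alt B_linr B_gen B_alt) dact_pi -B_phi.
Qed.

Lemma env_ext_wdg a b : env_ext (wdg a b, 0) = lbr (phi a) (phi b).
Proof. by rewrite /env_ext /= -/rho rho_wdg (linf0 phi_lin) addr0. Qed.

Lemma env_ext_odd a : env_ext (0, a) = phi a.
Proof. by rewrite /env_ext /= -/rho (linf0 rho_linear) add0r. Qed.

Lemma env_ext_linear : linear env_ext.
Proof.
by move=> l x y; rewrite /env_ext /= -/rho rho_linear phi_lin scalerDr addrACA.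
Qed.

Lemma env_ext_lbr x y : env_ext (lbr x y) = lbr (env_ext x) (env_ext y).
Proof.
case: x y => [u a] [v b]; rewrite /env_ext /= -/rho.
rewrite (linfD rho_linear) (linfB phi_lin) rho_ebrk rho_wdg -!rho_dact.
rewrite (linfD (lbr_linl _)) !(linfD (lbr_linr _)) (lbr_anti (phi a) (rho v)).
by rewrite -addrA (addrCA (w a b)) -addrA (addrC (w a b)).
Qed.
End UniversalProperty.

(** Even elements are combinations of wedges, which go to brackets of two odd elements, hence to
    degree 1 + 1 = 0. *)
Lemma env_ext_gr (k : fieldType) (T : lieTriple k) (L : grLie k) (phi : T -> L) :
  linear phi ->
  (forall a b c, phi (tbr a b c) = lbr (lbr (phi a) (phi b)) (phi c)) ->
  (forall a, phi a \in gr L 1) ->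
  forall i x, x \in gr (envelope T) i -> env_ext phi x \in gr L i.
Proof.
move=> phi_lin phi_tbr phi1; have [cl _ _] := gr_direct L.
have ext_lin := env_ext_linear phi_lin phi_tbr.
elim/Z2_case => -[u a]; rewrite ?env_gr0 ?env_gr1 /= => /eqP ->; last first.
  by rewrite env_ext_odd.
have [L00 L0lin] := cl 0.
have L0D v v' : v \in gr L 0 -> v' \in gr L 0 -> v + v' \in gr L 0.
  by move=> v0 v'0; rewrite -[v]scale1r L0lin.
pose incl (v : evenPart T) : envelope T := (v, 0).
have incl_lin : linear incl.
  by move=> l v v'; congr (_, _); rewrite /= scaler0 addr0.
have ei_lin : linear (env_ext phi \o incl).
  by move=> l v v'; rewrite /= incl_lin ext_lin.
rewrite -[env_ext _ _]/((env_ext phi \o incl) u).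
elim/quotW: u => e; rewrite -eval_wdg (eval_linear _ _ ei_lin).
elim: e => //= [e1 IH1 e2 IH2|l e IH|[b c]].
- exact: L0D.
- by rewrite -[_ *: _]addr0 L0lin.
- by rewrite env_ext_wdg //; have := gr_lbr (phi1 b) (phi1 c); rewrite Z2_1D1.
Qed.

(** The equaliser of [f] and [g] is a subalgebra containing the generators. *)
Lemma generated_hom_ext (k : fieldType) (K L : grLie k) (f g : grLie_hom K L) :
  lie_generated_by (gr K 1) -> {in gr K 1, f =1 g} -> f = g.
Proof.
move=> genK eqfg; apply: grLie_hom_eq => x; apply/eqP.
pose S : {pred K} := fun x => f x == g x.
have SE y : (y \in S) = (f y == g y) by [].
rewrite -SE; apply: genK => [|y /eqfg/eqP //].
have fl := grLie_fun_linear f; have gl := grLie_fun_linear g.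
split; first split=> [|l y z]; rewrite ?SE.
- by rewrite (linf0 fl) (linf0 gl).
- by move=> /eqP yS /eqP zS; rewrite fl gl yS zS.
by move=> y z; rewrite !SE !grLie_fun_lbr => /eqP -> /eqP ->.
Qed.

(** * The odd part of a graded Lie algebra *)

Section OddPart.
Context (k : fieldType) (L : grLie k).

Definition odd_pred : {pred L} := gr L 1.

Fact odd_submod_closed : GRing.submod_closed odd_pred.
Proof. by have [cl _ _] := gr_direct L; exact: cl. Qed.
HB.instance Definition _ :=
  GRing.isSubmodClosed.Build k L odd_pred odd_submod_closed.

Record odd_sub := OddSub { odd_val :> L; _ : odd_val \in odd_pred }.
HB.instance Definition _ := [isSub for odd_val].
HB.instance Definition _ := [Choice of odd_sub by <:].
HB.instance Definition _ := [SubChoice_isSubLmodule of odd_sub by <:].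

Lemma odd_valP (a : odd_sub) : odd_val a \in gr L 1. Proof. by case: a. Qed.

Lemma odd_val_inj : injective odd_val. Proof. exact: val_inj. Qed.

Lemma odd_val_linear : linear odd_val.
Proof. exact: (@linearP _ _ _ _ (val : odd_sub -> L)). Qed.

Fact odd_tbr_subproof (a b c : odd_sub) :
  lbr (lbr (odd_val a) (odd_val b)) (odd_val c) \in odd_pred.
Proof.
have := gr_lbr (gr_lbr (odd_valP a) (odd_valP b)) (odd_valP c).
by rewrite Z2_1D1 add0r.
Qed.

Definition odd_tbr (a b c : odd_sub) : odd_sub := OddSub (odd_tbr_subproof a b c).

Lemma odd_tbrE a b c :
  odd_val (odd_tbr a b c) = lbr (lbr (odd_val a) (odd_val b)) (odd_val c).
Proof. by []. Qed.

Fact odd_tbr_lin1 b c : linear (fun a => odd_tbr a b c).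
Proof.
move=> l a a'; apply: odd_val_inj.
by rewrite !(odd_val_linear, odd_tbrE) !lbr_linl.
Qed.

Fact odd_tbr_lin2 a c : linear (fun b => odd_tbr a b c).
Proof.
move=> l b b'; apply: odd_val_inj.
by rewrite !(odd_val_linear, odd_tbrE) lbr_linr lbr_linl.
Qed.

Fact odd_tbr_lin3 a b : linear (fun c => odd_tbr a b c).
Proof.
move=> l c c'; apply: odd_val_inj.
by rewrite !(odd_val_linear, odd_tbrE) lbr_linr.
Qed.

Fact odd_tbr_alt a b : odd_tbr a a b = 0.
Proof.
apply: odd_val_inj.
by rewrite odd_tbrE lbr_alt (linf0 (lbr_linl _)) (linf0 odd_val_linear).
Qed.

Fact odd_tbr_cyc a b c : odd_tbr a b c + odd_tbr b c a + odd_tbr c a b = 0.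
Proof.
apply: odd_val_inj; rewrite !(linfD odd_val_linear) (linf0 odd_val_linear).
rewrite !odd_tbrE !(lbr_anti (lbr _ _)) -!opprD.
by rewrite lbr_jacobi oppr0.
Qed.

Fact odd_tbr_der a b c d e :
  odd_tbr a b (odd_tbr c d e) =
    odd_tbr (odd_tbr a b c) d e + odd_tbr c (odd_tbr a b d) e +
    odd_tbr c d (odd_tbr a b e).
Proof.
apply: odd_val_inj; rewrite !(linfD odd_val_linear) !odd_tbrE lbr_der; congr (_ + _).
by rewrite lbr_der (linfD (lbr_linl _)).
Qed.

Definition odd_part : lieTriple k :=
  LieTriple odd_tbr_lin1 odd_tbr_lin2 odd_tbr_lin3
    odd_tbr_alt odd_tbr_cyc odd_tbr_der.
End OddPart.

Section OddMap.
Context (k : fieldType) (K L : grLie k) (f : grLie_hom K L).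

Definition odd_map_fun (a : odd_part K) : odd_part L :=
  OddSub (grLie_fun_gr f (odd_valP a)).

Fact odd_map_linear : linear odd_map_fun.
Proof.
move=> l a b; apply: odd_val_inj.
rewrite odd_val_linear -[LHS]/(f (odd_val (l *: a + b))).
by rewrite odd_val_linear grLie_fun_linear.
Qed.

Fact odd_map_tbr a b c :
  odd_map_fun (tbr a b c) = tbr (odd_map_fun a) (odd_map_fun b) (odd_map_fun c).
Proof. by apply: odd_val_inj; rewrite /= !grLie_fun_lbr. Qed.

Definition odd_map : lieTriple_hom (odd_part K) (odd_part L) :=
  LieTripleHom odd_map_linear odd_map_tbr.
End OddMap.

(** * Second cohomology with trivial coefficients *)

Section SecondCohomology.
Context (k : fieldType) (L : grLie k) (M : grMod L).
Implicit Types x y z : L.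

(** Curried form of a graded 2-cocycle for trivial coefficients: the terms of the coboundary that
    involve the action are absent. *)
Definition two_cocycle (b : L -> L -> M) : Prop :=
  [/\ forall y, linear (b^~ y), forall x, linear (b x), forall x, b x x = 0,
      forall x y z, b (lbr x y) z - b (lbr x z) y + b (lbr y z) x = 0
    & forall i j x y, x \in gr L i -> y \in gr L j -> b x y \in mgr M (i + j)].

(** Trades ordinals for natural numbers, so that the filter reduces by computation. *)
Lemma omit_args n (s : seq L) (t : seq 'I_n) :
  omit (args s) t = [seq nth 0 s l | l <- iota 0 n & l \notin map val t].
Proof.
rewrite -val_enum_ord filter_map -map_comp /omit.
have -> : [seq l <- enum 'I_n | l \notin t] =
          [seq l <- enum 'I_n | val l \notin map val t].
  by apply: eq_filter => l; rewrite mem_map //; exact: val_inj.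
by [].
Qed.

Lemma args1E (x : 'I_1 -> L) : x = args [:: x 0].
Proof. by apply/funext => i; rewrite [i]ord1. Qed.

Lemma args2E (x : 'I_2 -> L) : x = args [:: x 0; x 1].
Proof. by apply/funext; exact: Z2_case. Qed.

Hypothesis M_triv : trivial_module M.

Lemma delta1E (g : ('I_1 -> L) -> M) x y :
  delta g (args [:: x; y]) = - g (args [:: lbr x y]).
Proof.
rewrite /delta [X in X + _]big1 => [|i _]; last by rewrite M_triv scaler0.
rewrite add0r; under eq_bigr do rewrite big_mkcond.
rewrite !big_ord_recl !big_ord0 /= !omit_args /=.
by rewrite !add0r !addr0 expr1 scaleN1r.
Qed.

Lemma delta2E (f : ('I_2 -> L) -> M) x y z :
  delta f (args [:: x; y; z]) =
  - (f (args [:: lbr x y; z]) - f (args [:: lbr x z; y]) + f (args [:: lbr y z; x])).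
Proof.
rewrite /delta [X in X + _]big1 => [|i _]; last by rewrite M_triv scaler0.
rewrite add0r; under eq_bigr do rewrite big_mkcond.
rewrite !big_ord_recl !big_ord0 /= !omit_args /=.
(* The pairs (0,1), (0,2), (1,2) carry the signs -1, 1, -1; [bump] is left over from splitting off
   the first index. *)
rewrite -[(-1) ^+ (0 + bump 0 0)]/(-1) -[(-1) ^+ (0 + _)]/((-1) * (-1)).
rewrite -[(-1) ^+ (bump 0 0 + _)]/((-1) * ((-1) * (-1))).
rewrite mulrNN !mulr1 scale1r !scaleN1r !add0r !addr0 !opprD opprK -addrA.
by [].
Qed.

Lemma upd_args1 x u : upd (args [:: x] : 'I_1 -> L) 0 u = args [:: u].
Proof. by rewrite [LHS]args1E. Qed.
Lemma upd_args20 x y u : upd (args [:: x; y] : 'I_2 -> L) 0 u = args [:: u; y].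
Proof. by rewrite [LHS]args2E. Qed.
Lemma upd_args21 x y u : upd (args [:: x; y] : 'I_2 -> L) 1 u = args [:: x; u].
Proof. by rewrite [LHS]args2E. Qed.

Lemma cocycle_two_cocycle f :
  f \in cocycle (M := M) (n := 2) -> two_cocycle (fun x y => f (args [:: x; y])).
Proof.
case/andP=> /asboolP[[f_lin f_alt] f_gr] /eqP df; split.
(* The entry 0 in the tuple is a placeholder that [upd] overwrites. *)
- by move=> y l u v; have := f_lin (args [:: 0; y]) 0 l u v; rewrite !upd_args20.
- by move=> x l u v; have := f_lin (args [:: x; 0]) 1 l u v; rewrite !upd_args21.
- by move=> x; apply: (f_alt _ 0 1).
- move=> x y z; apply/eqP; rewrite -oppr_eq0 -delta2E df; exact/eqP.
- move=> i j x y xi yj.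
  have := f_gr (fun l => if l == 0 then i else j) (args [:: x; y]).
  by rewrite big_ord_recl big_ord1; apply; elim/Z2_case.
Qed.

Lemma two_cocycle_cocycle b : two_cocycle b ->
  (fun x : 'I_2 -> L => b (x 0) (x 1)) \in cocycle (M := M) (n := 2).
Proof.
case=> b_linl b_linr b_alt b_cocycle b_gr; apply/andP; split.
  apply/asboolP; split; last first.
    move=> d x xd; rewrite big_ord_recl big_ord1.
    by rewrite (_ : lift ord0 ord0 = 1); [exact: b_gr|exact: val_inj].
  split; first by move=> x; elim/Z2_case => l u v; rewrite /upd /= ?b_linl ?b_linr.
  by move=> x; elim/Z2_case; elim/Z2_case => // _ ->; rewrite b_alt.
apply/eqP/funext => x.
have -> : x = args [:: x 0; x 1; x (lift ord0 1)].
  apply/funext => -[[|[|[|//]]] lt_i]; rewrite /args /=;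
    congr (x _); exact: val_inj.
by rewrite delta2E /args /= b_cocycle oppr0.
Qed.

Lemma two_coboundary_GrHom (g : L -> M) : linear g ->
  (forall i x, x \in gr L i -> g x \in mgr M i) ->
  (fun x : 'I_1 -> L => g (x 0)) \in GrHom (M := M) (n := 1).
Proof.
move=> g_lin g_gr; apply/asboolP; split; last first.
  by move=> d x xd; rewrite big_ord1; exact: g_gr.
split; first by move=> x i l u v; rewrite [i]ord1 /upd /= g_lin.
by move=> x i j; rewrite [i]ord1 [j]ord1.
Qed.

(** Bridge between the quotient group and bilinear maps, used forwards for the counit and backwards
    for the envelope. *)
Lemma Hgr2_eq0P :
  (forall h : Hgr M 2, h = 0) <->
  (forall b, two_cocycle b -> exists g : L -> M,
    [/\ linear g, forall i x, x \in gr L i -> g x \in mgr M i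
      & forall x y, b x y = g (lbr x y)]).
Proof.
split=> [H b bZ|H h].
  pose f := ZGr (two_cocycle_cocycle bZ).
  have : f - 0 \in Bgr (M := M) (n := 2).
    by rewrite Quotient.idealrBE; apply/eqP; rewrite [LHS]H [RHS]H.
  rewrite subr0 => /asboolP[g /asboolP[[g_lin _] g_gr] fE].
  (* The sign compensates the one in [delta1E]. *)
  exists (fun x => - g (args [:: x])); split.
  - move=> l u v; have := g_lin (args [:: 0]) 0 l u v; rewrite !upd_args1 => ->.
    by rewrite opprD scalerN.
  - move=> i x xi; rewrite -scaleN1r -[_ *: _]addr0.
    have [/(_ i)[M0 Mlin] _ _] := mgr_direct M; apply: Mlin => //.
    have := g_gr (fun=> i) (args [:: x]); rewrite big_ord1; apply => j.
    by rewrite [j]ord1.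
  - move=> x y; rewrite -delta1E -fE; reflexivity.
elim/quotW: h => f; suff fB : f - 0 \in Bgr (M := M) (n := 2).
  by move: fB; rewrite Quotient.idealrBE => /eqP ->; rewrite !piE.
rewrite subr0.
have [g [g_lin g_gr bE]] := H _ (cocycle_two_cocycle (valP f)).
apply/asboolP; exists (fun x : 'I_1 -> L => - g (x 0)).
  rewrite -[X in X \in _]/(- (fun x : 'I_1 -> L => g (x 0))).
  by rewrite rpredN; exact: two_coboundary_GrHom.
apply/funext => x; rewrite [x]args2E delta1E opprK; exact: bE.
Qed.
End SecondCohomology.

(** * The envelope satisfies conditions (i) and (ii) *)

Section EnvelopeBrackets.
Context (k : fieldType) (T : lieTriple k).
Implicit Types (u v : evenPart T) (a b : T).
Local Notation E := (envelope T).

Lemma env_lbr_odd a b : lbr ((0, a) : E) (0, b) = (wdg a b, 0).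
Proof.
by congr (_, _); rewrite /= ?ebrk_alt ?add0r // !(linf0 (dact_linl _)) subrr.
Qed.

Lemma env_lbr_mixed u b : lbr ((u, 0) : E) (0, b) = (0, dact u b).
Proof.
have [wl _ _] := wdg_bialternating T.
congr (_, _); rewrite /=.
  by rewrite (linf0 (ebrk_linr _)) (linf0 (wl _)) addr0.
by rewrite (linf0 (dact_linl _)) subr0.
Qed.

Lemma envE (x : E) : x = (x.1, 0) + (0, x.2).
Proof. by case: x => u a; congr (_, _); rewrite /= ?addr0 ?add0r. Qed.

Lemma env_even_linear : linear (fun u => (u, 0) : E).
Proof. by move=> l u v; congr (_, _); rewrite /= scaler0 addr0. Qed.
End EnvelopeBrackets.

Section EnvelopeCohomology.
Context (k : fieldType) (T : lieTriple k) (M : grMod (envelope T)).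
Hypotheses (M_triv : trivial_module M) (M_gr : trivial_grading M).
Local Notation E := (envelope T).

Lemma mgr0T (m : M) : m \in mgr M 0.
Proof.
have [_ /(_ m)[m0 [m1 [m0M m1M ->]]] _] := mgr_direct M.
by rewrite (M_gr m1M) addr0.
Qed.

Lemma env_Hgr2_eq0 (h : Hgr M 2) : h = 0.
Proof.
move: h; apply/Hgr2_eq0P => // b [b_linl b_linr b_alt b_cocycle b_gr].
pose w a c := b (0, a) (0, c).
(* The cocycle on even elements; it plays the bracket required by the lift, with [wdg] as the second
   pairing. *)
pose B x v := b (\pi_(presented (@even_rel k T)) x, 0) (v, 0).
have b_anti x y : b x y = - b y x.
  apply/eqP; rewrite -addr_eq0; apply/eqP; have := b_alt (x + y).
  rewrite (linfD (b_linl _)) !(linfD (b_linr _)) !b_alt add0r addr0; exact.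
have w_alt : bialternating w.
  split=> [c l a a'|a l c c'|a]; rewrite /w ?b_alt // -(b_linl, b_linr).
    by congr (b (_, _) _); rewrite /= scaler0 addr0.
  by congr (b _ (_, _)); rewrite /= scaler0 addr0.
have B_linr x : linear (B x).
  by move=> l v v'; rewrite /B env_even_linear b_linr.
have B_gen x a c : B x (wdg a c) = w (eder x a) c + w a (eder x c).
  (* The cocycle identity on one even and two odd elements is the derivation rule. *)
  have := b_cocycle (\pi_(presented (@even_rel k T)) x, 0) (0, a) (0, c).
  rewrite !env_lbr_mixed env_lbr_odd !dact_pi => /eqP.
  rewrite addr_eq0 -(b_anti _ (wdg a c, 0)) => /eqP bE; rewrite /B -bE.
  by rewrite (b_anti (0, eder x c)) opprK.
have B_alt x : B x (eval (unc (@wdg k T)) x) = 0 by rewrite eval_wdg /B b_alt.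
have g_lin := even_lift_linear w_alt B_linr B_gen B_alt.
(* A primitive of degree 0 must kill the odd component, as M_1 = 0. *)
exists (fun x => even_lift w x.1); split=> [l x y|i x|x y].
- exact: g_lin.
- elim/Z2_case: i => [_|]; first exact: mgr0T.
  rewrite env_gr1 => /eqP ->; rewrite (linf0 g_lin).
  by have [/(_ 1)[]] := mgr_direct M.
(* These values have degree 1, where [M] vanishes. *)
have mixed u c : b (u, 0) (0, c) = 0.
  apply: M_gr; rewrite -[1]add0r.
  by apply: b_gr; rewrite ?env_gr0 ?env_gr1.
case: x y => [u a] [v c]; rewrite (envE (u, a)) (envE (v, c)) /=.
rewrite (linfD (b_linl _)) !(linfD (b_linr _)) mixed (b_anti (0, a) (v, 0)) mixed.
rewrite oppr0 addr0 add0r.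
rewrite !(addr0, add0r) (linfD g_lin).
rewrite (even_lift_wdg w_alt B_linr B_gen B_alt); congr (_ + _).
elim/quotW: u => x; elim/quotW: v => y.
by rewrite (even_lift_ebrk w_alt B_linr B_gen B_alt) eval_wdg.
Qed.
End EnvelopeCohomology.

(** * The counit is an isomorphism *)

(** The inverse is chosen pointwise and inherits its properties from injectivity; surjectivity in
    each degree makes it graded. *)
Lemma grLie_isomorphism (k : fieldType) (K L : grLie k) (f : grLie_hom K L) :
  injective f ->
  (forall i y, y \in gr L i -> exists2 x, x \in gr K i & f x = y) ->
  @isomorphism (grLieCat k) K L f.
Proof.
move=> f_inj f_surj.
have f_surjT y : exists x, f x = y.
  have [_ /(_ y)[y0 [y1 [y0L y1L ->]]] _] := gr_direct L.
  have [[x0 _ <-] [x1 _ <-]] := (f_surj _ _ y0L, f_surj _ _ y1L).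
  by exists (x0 + x1); rewrite (linfD (grLie_fun_linear f)).
pose g y := sval (cid (f_surjT y)).
have gK y : f (g y) = y by rewrite /g; case: cid.
have g_lin : linear g.
  by move=> l x y; apply: f_inj; rewrite grLie_fun_linear !gK.
have g_lbr x y : g (lbr x y) = lbr (g x) (g y).
  by apply: f_inj; rewrite grLie_fun_lbr !gK.
have g_gr i y : y \in gr L i -> g y \in gr K i.
  move=> /f_surj[x xK <-]; rewrite (_ : g (f x) = x) //.
  by apply: f_inj; rewrite gK.
exists (GrLieHom g_lin g_lbr g_gr).
by split; apply: grLie_hom_eq => x //=; apply: f_inj; rewrite gK.
Qed.

Section TrivialModule.
Context (k : fieldType) (L : grLie k) (V : lmodType k).

Definition triv_mgr (i : 'Z_2) : {pred V} := fun v => (i == 0) || (v == 0).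

Lemma triv_mgrE i v : (v \in triv_mgr i) = (i == 0) || (v == 0).
Proof. by []. Qed.

Fact triv_mgr_direct : direct_decomposition triv_mgr.
Proof.
split=> [i|v|v _]; last by move/eqP.
- split=> [|l u v]; first by rewrite triv_mgrE eqxx orbT.
  rewrite !triv_mgrE; case: (i == 0) => //= /eqP -> /eqP ->.
  by rewrite scaler0 addr0.
- by exists v, 0; rewrite addr0; split=> //; rewrite triv_mgrE eqxx orbT.
Qed.

Fact triv_act_linl (m : V) : linear (fun _ : L => 0 : V).
Proof. by move=> l x y; rewrite scaler0 addr0. Qed.

Fact triv_act_linr (x : L) : linear (fun _ : V => 0 : V).
Proof. by move=> l u v; rewrite scaler0 addr0. Qed.

Fact triv_act_lbr (x y : L) (m : V) : 0 = 0 - 0 :> V.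
Proof. by rewrite subrr. Qed.

Fact triv_act_mgr (i j : 'Z_2) (x : L) (m : V) :
  x \in gr L i -> m \in triv_mgr j -> 0 \in triv_mgr (i + j).
Proof. by move=> _ _; rewrite triv_mgrE eqxx orbT. Qed.

Definition triv_module : grMod L :=
  GrMod triv_act_linl triv_act_linr triv_act_lbr triv_mgr_direct triv_act_mgr.
End TrivialModule.

Section EnvHom.
Context (k : fieldType) (T : lieTriple k) (L : grLie k).
Context (f : lieTriple_hom T (odd_part L)).

Let phi a : L := odd_val (f a).

Fact env_hom_linear : linear phi.
Proof. by move=> l a b; rewrite /phi lieTriple_fun_linear odd_val_linear. Qed.

Fact env_hom_tbr a b c : phi (tbr a b c) = lbr (lbr (phi a) (phi b)) (phi c).
Proof. by rewrite /phi lieTriple_fun_tbr. Qed.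

(** The transpose of [f]: [envelope] is left adjoint to [odd_part]. *)
Definition env_hom : grLie_hom (envelope T) L :=
  GrLieHom (env_ext_linear env_hom_linear env_hom_tbr)
    (env_ext_lbr env_hom_linear env_hom_tbr)
    (env_ext_gr env_hom_linear env_hom_tbr (fun a => odd_valP (f a))).

Lemma env_hom_odd a : env_hom (0, a) = odd_val (f a).
Proof. exact: (env_ext_odd env_hom_linear env_hom_tbr). Qed.
End EnvHom.

Section Counit.
Context (k : fieldType) (L : grLie k).
Hypothesis L_gen : lie_generated_by (gr L 1).
Hypothesis L_H2 : forall M : grMod L,
  trivial_module M -> trivial_grading M -> forall h : Hgr M 2, h = 0.

Local Notation E := (envelope (odd_part L)).

Definition counit : grLie_hom E L := env_hom (lieTriple_id (odd_part L)).

Let eps := counit.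
Let eps_lin : linear eps := grLie_fun_linear eps.
Let eps_lbr x y : eps (lbr x y) = lbr (eps x) (eps y) := grLie_fun_lbr eps x y.
Let eps_odd a : eps (0, a) = odd_val a. Proof. exact: env_hom_odd. Qed.

(** The image is a subalgebra containing L_1. *)
Let eps_surj y : exists x, eps x = y.
Proof.
pose S : {pred L} := fun y => `[< exists x, eps x = y >].
suff /asboolP : y \in S by [].
apply: L_gen => [|a a1]; last first.
  by apply/asboolP; exists (0, OddSub a1); rewrite eps_odd.
split; first split.
- by apply/asboolP; exists 0; rewrite (linf0 eps_lin).
- move=> l _ _ /asboolP[x <-] /asboolP[x' <-].
  by apply/asboolP; exists (l *: x + x'); rewrite eps_lin.
move=> _ _ /asboolP[x <-] /asboolP[x' <-].
by apply/asboolP; exists (lbr x x'); rewrite eps_lbr.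
Qed.

(** The odd component of [eps x] is [x.2] seen in [L]; if [eps x] is even, that component lies in
    both L_0 and L_1. In particular the kernel is even. *)
Let eps_gr0 x : eps x \in gr L 0 -> x.2 = 0.
Proof.
have [cl _ dj] := gr_direct L; have [L00 L0lin] := cl 0.
move=> ex0; apply: odd_val_inj; rewrite (linf0 (@odd_val_linear _ L)).
apply: dj; last exact: odd_valP.
have -> : odd_val x.2 = (-1) *: eps (x.1, 0) + eps x.
  by rewrite {3}(envE x) (linfD eps_lin) eps_odd scaleN1r addrA addNr add0r.
by apply: L0lin => //; apply: grLie_fun_gr; rewrite env_gr0.
Qed.

Let eps_gr_surj i y : y \in gr L i -> exists2 x, x \in gr E i & eps x = y.
Proof.
elim/Z2_case: i => yL; last first.
  by exists (0, OddSub yL); rewrite ?env_gr1 // eps_odd.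
(* Any preimage of an even element is itself even. *)
have [x xy] := eps_surj y; exists x => //.
by rewrite env_gr0 (eps_gr0 (x := x)) // xy.
Qed.

(** The centraliser of [x] is a subalgebra, so odd [y] suffice. The bracket of the even [x] with an
    odd element is odd and is killed by [eps], which is injective on odd elements. *)
Let eps_ker_central x y : eps x = 0 -> lbr x y = 0.
Proof.
move=> ex0; have x2 : x.2 = 0.
  by apply: eps_gr0; rewrite ex0; have [/(_ 0)[]] := gr_direct L.
case: x x2 ex0 => u a; rewrite -[(u, a).2]/a => -> ex0 {a}.
pose S : {pred E} := fun y => lbr ((u, 0) : E) y == 0.
apply/eqP; rewrite -[_ == _]/(y \in S); apply: env_generated => [|[v c]].
  split; first split.
  - by rewrite unfold_in (linf0 (lbr_linr _)).
  - move=> l z z'; rewrite !unfold_in lbr_linr => /eqP -> /eqP ->.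
    by rewrite scaler0 addr0.
  move=> z z'; rewrite !unfold_in lbr_der => /eqP -> /eqP ->.
  by rewrite (linf0 (lbr_linl _)) (linf0 (lbr_linr _)) addr0.
rewrite env_gr1 /= => /eqP ->; rewrite unfold_in env_lbr_mixed.
have /odd_val_inj -> // : odd_val (dact u c) = odd_val 0.
rewrite -!eps_odd -env_lbr_mixed eps_lbr ex0.
by rewrite (linf0 (lbr_linl _)) (linf0 eps_lin).
Qed.

Let eps_lbr_eq x x' y y' :
  eps x = eps x' -> eps y = eps y' -> lbr x y = lbr x' y'.
Proof.
move=> ex ey; have kerB z z' : eps z = eps z' -> eps (z - z') = 0.
  by move=> ez; rewrite (linfB eps_lin) ez subrr.
apply/eqP; rewrite -subr_eq0; apply/eqP.
(* Both terms on the right are brackets with kernel elements. *)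
have -> : lbr x y - lbr x' y' = lbr (x - x') y - lbr (y - y') x'.
  rewrite (linfB (lbr_linl _)) (linfB (lbr_linl _)) (lbr_anti y) (lbr_anti y').
  by rewrite opprB opprK [- _ + _]addrC addrA subrK.
by rewrite !eps_ker_central ?subrr //; exact: kerB.
Qed.

(* Lifting to the envelope and taking brackets there is well defined because the
   kernel of the counit is central; a primitive [g] of the resulting cocycle
   with values in the even part recovers [u] from [eps (u, 0)]. *)
Lemma counit_inj : injective counit.
Proof.
(* A set-theoretic section; [b] is nevertheless bilinear because, by [bE], its values do not depend
   on the lifts. *)
pose s y : E := sval (cid (eps_surj y)).
have sK y : eps (s y) = y by rewrite /s; case: cid.
pose b x y := (lbr (s x) (s y)).1.
have bE x y : b (eps x) (eps y) = (lbr x y).1.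
  by rewrite /b (eps_lbr_eq (x' := x) (y' := y)).
pose M := triv_module L (evenPart (odd_part L)).
have bZ : @two_cocycle k L M b.
  split.
  - move=> y l x x'; rewrite -[x]sK -[x']sK -[y]sK -eps_lin !bE.
    by rewrite lbr_linl.
  - move=> x l y y'; rewrite -[x]sK -[y]sK -[y']sK -eps_lin !bE.
    by rewrite lbr_linr.
  - by move=> x; rewrite /b lbr_alt.
  (* The even component of the Jacobi identity in the envelope. *)
  - move=> x y z; rewrite -[x]sK -[y]sK -[z]sK -!eps_lbr !bE.
    move: (s x) (s y) (s z) => {}x {}y {}z.
    rewrite -[LHS]/((lbr (lbr x y) z - lbr (lbr x z) y + lbr (lbr y z) x).1).
    rewrite (lbr_anti _ x) lbr_der opprD (lbr_anti y) opprK addrA addrAC.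
    by rewrite subrK subrr.
  (* Homogeneous arguments have homogeneous lifts; in odd total degree their bracket has no even
     component. *)
  - move=> i j x y /eps_gr_surj[{}x xi <-] /eps_gr_surj[{}y yj <-].
    rewrite bE; have := gr_lbr xi yj.
    by elim/Z2_case: (i + j) => //; rewrite env_gr1 => /eqP ->.
have M_triv : trivial_module M by [].
have M_gr : trivial_grading M by move=> m /eqP.
have [g [g_lin _ bg]] := (Hgr2_eq0P M_triv).1 (L_H2 M_triv M_gr) b bZ.
(* It suffices to check wedges, which are brackets of odd elements, so [bg] applies. *)
have gK u : g (eps (u, 0)) = u.
  move: u; apply: even_hom_ext => [l u v|//|a c].
    by rewrite env_even_linear eps_lin g_lin.
  by rewrite -env_lbr_odd eps_lbr -bg bE env_lbr_odd.
move=> x y exy; apply/eqP; rewrite -subr_eq0; apply/eqP.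
have exy0 : eps (x - y) = 0 by rewrite (linfB eps_lin) exy subrr.
have xy2 : (x - y).2 = 0.
  by apply: eps_gr0; rewrite exy0; have [/(_ 0)[]] := gr_direct L.
case: (x - y) xy2 exy0 => u a; rewrite -[(u, a).2]/a => -> eu0.
by rewrite -[u]gK eu0 (linf0 g_lin).
Qed.

Lemma counit_isomorphism : @isomorphism (grLieCat k) E L counit.
Proof. exact: grLie_isomorphism counit_inj eps_gr_surj. Qed.
End Counit.

(** * The equivalence *)

Section Unit.
Context (k : fieldType) (T : lieTriple k).

Lemma env_odd_proof (a : T) : ((0, a) : envelope T) \in gr (envelope T) 1.
Proof. by rewrite env_gr1. Qed.

Definition unit_fun (a : T) : odd_part (envelope T) := OddSub (env_odd_proof a).

Fact unit_linear : linear unit_fun.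
Proof.
move=> l a b; apply: odd_val_inj; rewrite odd_val_linear.
by congr (_, _); rewrite /= scaler0 addr0.
Qed.

Fact unit_tbr a b c :
  unit_fun (tbr a b c) = tbr (unit_fun a) (unit_fun b) (unit_fun c).
Proof.
apply: odd_val_inj; rewrite odd_tbrE.
by rewrite env_lbr_odd env_lbr_mixed dact_wdg.
Qed.

Definition env_unit : lieTriple_hom T (odd_part (envelope T)) :=
  LieTripleHom unit_linear unit_tbr.

(** Despite its name this inverts [unit_fun]; it is not the underlying map of [counit]. *)
Definition counit_fun (a : odd_part (envelope T)) : T := (odd_val a).2.

Fact unitK : cancel unit_fun counit_fun. Proof. by []. Qed.

Fact counitK : cancel counit_fun unit_fun.
Proof.
move=> a; apply: odd_val_inj; have := odd_valP a; rewrite env_gr1.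
by rewrite /counit_fun /=; case: (odd_val a) => u b /= /eqP ->.
Qed.

Fact counit_fun_linear : linear counit_fun.
Proof. by move=> l a b; rewrite /counit_fun odd_val_linear. Qed.

Fact counit_fun_tbr a b c :
  counit_fun (tbr a b c) = tbr (counit_fun a) (counit_fun b) (counit_fun c).
Proof.
rewrite -[a in LHS]counitK -[b in LHS]counitK -[c in LHS]counitK.
by rewrite -unit_tbr unitK.
Qed.

Definition env_unit_inv : lieTriple_hom (odd_part (envelope T)) T :=
  LieTripleHom counit_fun_linear counit_fun_tbr.
End Unit.

Section Functors.
Context (k : fieldType).

Definition env_map (S T : lieTriple k) (f : lieTriple_hom S T) :
    grLie_hom (envelope S) (envelope T) :=
  env_hom (lieTriple_comp (env_unit T) f).

Lemma env_map_odd S T (f : lieTriple_hom S T) a : env_map f (0, a) = (0, f a).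
Proof. exact: env_hom_odd. Qed.

Lemma env_hom_ext (T : lieTriple k) (L : grLie k) (f g : grLie_hom (envelope T) L) :
  (forall a, f (0, a) = g (0, a)) -> f = g.
Proof.
move=> eqfg; apply: generated_hom_ext (@env_generated _ T) _ => -[u a].
by rewrite env_gr1 => /eqP /= ->.
Qed.

(** Spelled as in the theorem, so that the two full subcategories agree by conversion. *)
Let P (L : grLie k) :=
  lie_generated_by (gr L 1) /\
  forall M : grMod L, trivial_module M -> trivial_grading M ->
    forall h : Hgr M 2, h = 0.

Lemma envelope_P (T : lieTriple k) : P (envelope T).
Proof. by split; [exact: env_generated|exact: env_Hgr2_eq0]. Qed.

(** Ended by [Defined], since the naturality squares are typed by computing the object maps. *)
Definition env_functor :
    functor (lieTripleCat k) (@full_subcategory (grLieCat k) P).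
Proof.
refine (@Functor (lieTripleCat k) (@full_subcategory (grLieCat k) P)
  (fun T => exist P (envelope T) (envelope_P T)) env_map _ _).
- by move=> T; apply: env_hom_ext => a; rewrite env_map_odd.
- move=> R S T g f; apply: env_hom_ext => a.
  by rewrite -[RHS]/(env_map g (env_map f (0, a))) !env_map_odd.
Defined.

Definition odd_functor :
    functor (@full_subcategory (grLieCat k) P) (lieTripleCat k).
Proof.
refine (@Functor (@full_subcategory (grLieCat k) P) (lieTripleCat k)
  (fun L => odd_part (sval L)) (fun K L => @odd_map k (sval K) (sval L)) _ _).
- by move=> L; apply: lieTriple_hom_eq => a; exact: odd_val_inj.
- by move=> J K L g f; apply: lieTriple_hom_eq => a; exact: odd_val_inj.
Defined.

Lemma odd_env_nat_isomorphic :
  nat_isomorphic (functor_comp odd_functor env_functor) (functor_id (lieTripleCat k)).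
Proof.
exists (@env_unit_inv k); split=> [S T f|T].
  apply: lieTriple_hom_eq => a; rewrite -[a]counitK.
  by rewrite -[LHS]/((env_map f (0, counit_fun a)).2) env_map_odd.
exists (env_unit T); split; apply: lieTriple_hom_eq => a //=.
exact: counitK.
Qed.

Lemma env_odd_nat_isomorphic :
  nat_isomorphic (functor_comp env_functor odd_functor)
    (functor_id (@full_subcategory (grLieCat k) P)).
Proof.
exists (fun L => counit (sval L)); split=> [K L f|[L [L_gen L_H2]]]; last first.
  exact: counit_isomorphism.
(* The source is an envelope, so the naturality square need only be checked on odd elements. *)
apply: env_hom_ext => a.
rewrite -[LHS]/(counit (sval L) (env_map (odd_map f) (0, a))) env_map_odd.
by rewrite -[RHS]/(f (counit (sval K) (0, a))) !env_hom_odd.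
Qed.
End Functors.

Theorem theoremA (k : fieldType) :
  cat_equivalent
    (lieTripleCat k)
    (@full_subcategory (grLieCat k) (fun L : grLie k =>
       lie_generated_by (gr L 1) /\
       forall M : grMod L, trivial_module M -> trivial_grading M ->
         forall h : Hgr M 2, h = 0)).
Proof.
exists (env_functor k), (odd_functor k).
by split; [exact: odd_env_nat_isomorphic|exact: env_odd_nat_isomorphic].
Qed.
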